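(* Let $n\ge 2k\ge1$ and let $V$ be a set with $|V|=n$. Fix a sequence $x_1,y_1,\ldots,x_k,y_k$ of $2k$ distinct elements of $V$, for $0\le i\le k$ define $\phi_i:V^{(k)}\to\mathbb{R}$ by $\phi_i(A)=(-1)^{|A\cap\{y_1,\ldots,y_i\}|}$ if $|A\cap\{x_j,y_j\}|=1$ for all $j=1,\ldots,i$ and $\phi_i(A)=0$ otherwise, and let $V_i\subseteq\mathbb{R}^{V^{(k)}}$ be the linear span of $\{(\phi_i)_\pi:\pi\in S(V)\}$. Then: (a) For $i\ge1$ and $w:V^{(k)}\to\mathbb{R}$, $\operatorname{disc}(w,\phi_i)=0$ if and only if $w\in V_i^\perp$. (b) If $u\in V_i$ and $w\in V_j$ with $i\ne j$, then $\operatorname{disc}(u,w)=0$. (c) $\mathbb{R}^{V^{(k)}}$ is the direct sum $V_0\oplus\cdots\oplus V_k$. (d) If $u=u_0+\cdots+u_k$ with $u_i\in V_i$ for each $i$, and $(U_0,\ldots,U_k)$ is the $W$-vector of $u$, then for each $i=0,\ldots,k$ we have $U_i=0$ if and only if $u_i=\mathbf 0$. (e) If $w_1,\ldots,w_t:V^{(k)}\to\mathbb{R}$ are nonzero and satisfy $\operatorname{disc}(w_i,w_j)=0$ for all $i\ne j$, then there is a partition $[k]=I_1\cup\cdots\cup I_t$ (into pairwise disjoint, possibly empty, sets) such that $w_i\in V_0\oplus\bigoplus_{h\in I_i}V_h$ for each $i$.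
   Context: $V^{(k)}$ is the family of $k$-subsets of $V$; $S(V)$ is the symmetric group on $V$; $[k]=\{1,\dots,k\}$. Weightings $w:V^{(k)}\to\mathbb{R}$ carry the inner product $\langle w,u\rangle=\sum_{e}w(e)u(e)$ (orthogonal complements $\perp$ are taken with respect to it); $w(V)=\sum_e w(e)$, $d(w)=w(V)/\binom nk$, $w_\pi(e)=w(\pi^{-1}(e))$, and $\operatorname{disc}(w,u)=\max_{\pi\in S(V)}|\langle w_\pi,u\rangle-d(w)d(u)\binom nk|$. Note $\phi_0$ is the constant function $1$. $W$-vector (defined recursively on $k$): $W_0=|w(V)|/\binom nk$ (for $k=0$, $w$ is a single real number and $W_0=|w|$). For $k\ge1$ and distinct $x,y\in V$, $w^{xy}:(V\setminus\{x,y\})^{(k-1)}\to\mathbb{R}$ is $w^{xy}(e)=w(e\cup\{x\})-w(e\cup\{y\})$; with $(W^{xy}_0,\ldots,W^{xy}_{k-1})$ its $W$-vector, $W_i=\frac{1}{n(n-1)}\sum_{(x,y):\,x\ne y}W^{xy}_{i-1}$ for $1\le i\le k$ (average over ordered pairs of distinct vertices). *)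

(* Defs.v *)
From HB Require Import structures.
From mathcomp Require Import all_boot all_order all_fingroup all_algebra.
Set Implicit Arguments. Unset Strict Implicit. Unset Printing Implicit Defensive.
Import Order.TTheory GRing.Theory Num.Theory.
Local Open Scope ring_scope.

Section Defs.
Variables (R : realFieldType) (T : finType) (k : nat).

Local Notation kset := {A : {set T} | #|A| == k}.

Local Notation weighting := {ffun kset -> R}.

Definition inner (w u : weighting) : R := \sum_(e : kset) w e * u e.

Definition wtot (w : weighting) : R := \sum_(e : kset) w e.
Definition dens (w : weighting) : R := wtot w / ('C(#|T|, k))%:R.

(* w_pi(e) = w(pi^{-1}(e)); the default of insubd is never used since
   pi^{-1}(e) is again a k-set. *)
Definition permw (pi : {perm T}) (w : weighting) : weighting :=
  [ffun e : kset => w (insubd e ((pi^-1)%g @: val e))].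

Definition disc (w u : weighting) : R :=
  \big[Num.max/0]_(pi : {perm T})
     `| inner (permw pi w) u - dens w * dens u * ('C(#|T|, k))%:R |.

Definition phi (x y : 'I_k -> T) (i : nat) : weighting :=
  [ffun e : kset =>
    if [forall j : 'I_k, (j < i)%N ==> (#|val e :&: [set x j; y j]| == 1)%N]
    then (-1) ^+ #|val e :&: [set y j | j : 'I_k & (j < i)%N]|
    else 0].

Definition inV (x y : 'I_k -> T) (i : nat) (w : weighting) : Prop :=
  exists c : {perm T} -> R,
    w = [ffun e => \sum_(pi : {perm T}) c pi * permw pi (phi x y i) e].

Definition inVperp (x y : 'I_k -> T) (i : nat) (w : weighting) : Prop :=
  forall v, inV x y i v -> inner w v = 0.

Definition wext (w : weighting) : {set T} -> R :=
  fun A => match @insub _ (fun B : {set T} => #|B| == k) kset A with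
           | Some e => w e | None => 0 end.

End Defs.

(* W-vector of a weighting f of the m-subsets of the vertex set S
   (f given on all subsets of T; only its values on m-subsets of S matter).
   Wv m S f i is the i-th component W_i, 0 <= i <= m. *)
Fixpoint Wv (R : realFieldType) (T : finType) (m : nat) (S : {set T})
    (f : {set T} -> R) (i : nat) {struct m} : R :=
  match i, m with
  | 0%N, _ =>
      `| \sum_(A : {set T} | (A \subset S) && (#|A| == m)) f A |
        / ('C(#|S|, m))%:R
  | i'.+1, 0%N => 0
  | i'.+1, m'.+1 =>
      (\sum_(a in S) \sum_(b in S | b != a)
          Wv m' (S :\ a :\ b) (fun e => f (a |: e) - f (b |: e)) i')
        / ((#|S| * (#|S| - 1))%N)%:R
  end.

Definition Wvec (R : realFieldType) (T : finType) (k : nat)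
  (w : {ffun {A : {set T} | #|A| == k} -> R}) (i : nat) : R := Wv k [set: T] (wext w) i.

Notation kset T k := {A : {set T} | #|A| == k}.
Notation weighting R T k := {ffun kset T k -> R}.
Arguments phi {R T k} x y i.
Arguments inV {R T k} x y i w.
Arguments inVperp {R T k} x y i w.

(* Main.v *)
(** On k-sets A, [phi_i(A)] is the product over [j <= i] of [[x_j in A] - [y_j in A]].
    Expanding a translate of [phi_i] into functions [A |-> [B \subset A]] with
    [|B| = i] shows that it is orthogonal to [phi_j] for [j > i]: some pair
    [{x_s, y_s}], [s <= j], misses B, and swapping it negates [phi_j] only.
    Unfolding the recursion, the i-th component of the W-vector of w vanishes iff
    w is orthogonal to all translates of [phi_i]; and if all components vanish,
    induction on k gives [w^{xy} = 0] for all x <> y, so w is constant, hence 0.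
    So the [V_i] span, and (c), (d) follow.  For (e), if [<w, phi_h> <> 0] with
    [h >= 1], then [phi_h] is a combination of translates of w with coefficient
    sum 0, so that [disc(w, v) = 0] forces v to be orthogonal to [V_h]. *)
Require Import Defs.
From HB Require Import structures.
From mathcomp Require Import all_boot all_order all_fingroup all_algebra.
Import Order.TTheory GRing.Theory Num.Theory.
Set Implicit Arguments. Unset Strict Implicit. Unset Printing Implicit Defensive.
Local Open Scope ring_scope.

(** * Extending partial injections, and spanning by duality *)

Lemma perm_extends_seq (T : finType) (s t : seq T) :
  uniq s -> uniq t -> size s = size t ->
  exists p : {perm T}, map p s = t.
Proof.
elim: s t => [|a s IHs] [|b t] //=; first by exists 1%g.
case/andP=> as_ us /andP[bt ut] [st].
have [p Ep] := IHs t us ut st.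
(* The transposition corrects the image of [a] and leaves the tail alone, since neither [p a] nor
   [b] occurs in [t]. *)
exists (p * tperm (p a) b)%g => /=.
rewrite permM tpermL -[in RHS]Ep; congr (_ :: _).
apply/eq_in_map => c cs; rewrite permM tpermD //.
  by rewrite (inj_eq perm_inj); apply: contraNneq as_ => ->.
by apply: contraNneq bt => ->; rewrite -Ep map_f.
Qed.

(** Take the [g i] as rows of a matrix. Each column of its cokernel annihilates all of them, hence
    is zero, so the row space is everything. *)
Lemma span_of_trivial_annihilator (R : fieldType) (I E : finType)
    (g : I -> E -> R) :
  (forall w : E -> R, (forall i, \sum_e w e * g i e = 0) ->
     forall e, w e = 0) ->
  forall w : E -> R, exists c : I -> R, forall e, w e = \sum_i c i * g i e.
Proof.
move=> triv w.
pose G : 'M[R]_(#|I|, #|E|) := \matrix_(i, j) g (enum_val i) (enum_val j).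
have sumE (F : E -> R) : \sum_e F e = \sum_(j < #|E|) F (enum_val j).
  by rewrite (reindex _ (onW_bij _ (@enum_val_bij E))).
have sumI (F : I -> R) : \sum_i F i = \sum_(j < #|I|) F (enum_val j).
  by rewrite (reindex _ (onW_bij _ (@enum_val_bij I))).
have cok0 : cokermx G = 0.
  apply/matrixP => j l; rewrite [RHS]mxE.
  have := triv (fun e => cokermx G (enum_rank e) l).
  move=> /(_ _ (enum_val j)); rewrite enum_valK; apply=> i.
  have := mulmx_coker G => /matrixP /(_ (enum_rank i) l).
  rewrite !mxE sumE => E0; rewrite -[RHS]E0.
  by apply: eq_bigr => m _; rewrite !mxE enum_rankK enum_valK mulrC.
have /submxP[D wD] : ((\row_j w (enum_val j)) <= G)%MS.
  by rewrite submxE cok0 mulmx0.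
exists (fun i => D 0 (enum_rank i)) => e.
have /matrixP/(_ 0 (enum_rank e)) := wD; rewrite !mxE enum_rankK => ->.
by rewrite sumI; apply: eq_bigr => i _; rewrite !mxE enum_valK enum_rankK.
Qed.

(** * The action of permutations on k-sets *)

Section KSets.
Variables (T : finType) (k : nat).

Definition kact (p : {perm T}) (e : kset T k) : kset T k := insubd e (p @: val e).

Lemma val_kact p e : val (kact p e) = p @: val e.
Proof. by rewrite val_insubd card_imset ?(valP e) //; apply: perm_inj. Qed.

Lemma mem_kact p e a : (a \in val (kact p e)) = ((p^-1)%g a \in val e).
Proof.
by rewrite val_kact -{1}[a](permKV p) mem_imset //; apply: perm_inj.
Qed.

Lemma kset_ext (e f : kset T k) : val e =i val f -> e = f.
Proof. by move=> ef; apply/val_inj/setP. Qed.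

Lemma kactM p q e : kact (p * q)%g e = kact q (kact p e).
Proof. by apply: kset_ext => a; rewrite !mem_kact invMg permM. Qed.

Lemma kact1 e : kact 1%g e = e.
Proof. by apply: kset_ext => a; rewrite mem_kact invg1 perm1. Qed.

Lemma kactK p : cancel (kact p) (kact p^-1%g).
Proof. by move=> e; rewrite -kactM mulgV kact1. Qed.

Lemma kactKV p : cancel (kact p^-1%g) (kact p).
Proof. by move=> e; rewrite -kactM mulVg kact1. Qed.

Lemma kact_bij p : bijective (kact p).
Proof. exact: Bijective (kactK p) (kactKV p). Qed.

Lemma kact_tperm_fix a b (e : kset T k) :
  (a \in val e) = (b \in val e) -> kact (tperm a b) e = e.
Proof.
move=> ab; apply: kset_ext => c; rewrite mem_kact tpermV.
by case: tpermP => [->|->|].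
Qed.

End KSets.

(** * Translates, inner products and discrepancy of weightings *)

Section Weightings.
Variables (R : realFieldType) (T : finType) (k : nat).
Implicit Types (w u v : weighting R T k) (p q : {perm T}).

Lemma permwE p w e : permw p w e = w (kact p^-1%g e).
Proof. by rewrite ffunE. Qed.

Lemma permwM p q w : permw p (permw q w) = permw (q * p)%g w.
Proof. by apply/ffunP => e; rewrite !permwE invMg kactM. Qed.

Lemma permw1 w : permw 1%g w = w.
Proof. by apply/ffunP => e; rewrite permwE invg1 kact1. Qed.

Lemma permw_inj p : injective (@permw R T k p).
Proof. by apply: (can_inj (g := permw p^-1%g)) => w; rewrite permwM mulgV permw1. Qed.

Lemma permwB p w u : permw p (w - u) = permw p w - permw p u.
Proof. by apply/ffunP => e; rewrite permwE !ffunE. Qed.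

Lemma permwN p w : permw p (- w) = - permw p w.
Proof. by apply/ffunP => e; rewrite permwE !ffunE. Qed.

Lemma permw_sum p (I : finType) (P : pred I) (F : I -> weighting R T k) :
  permw p (\sum_(i | P i) F i) = \sum_(i | P i) permw p (F i).
Proof.
by apply/ffunP => e; rewrite permwE !sum_ffunE; apply: eq_bigr => i _; rewrite permwE.
Qed.

Lemma innerC w u : inner w u = inner u w.
Proof. by apply: eq_bigr => e _; rewrite mulrC. Qed.

Lemma innerBl w u v : inner (w - u) v = inner w v - inner u v.
Proof.
rewrite /inner -sumrB; apply: eq_bigr => e _.
by rewrite !ffunE mulrBl.
Qed.

Lemma innerNr w v : inner w (- v) = - inner w v.
Proof. by rewrite /inner -sumrN; apply: eq_bigr => e _; rewrite ffunE mulrN. Qed.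

Lemma inner_suml (I : finType) (P : pred I) (F : I -> weighting R T k) v :
  inner (\sum_(i | P i) F i) v = \sum_(i | P i) inner (F i) v.
Proof.
rewrite /inner exchange_big; apply: eq_bigr => e _ /=.
by rewrite sum_ffunE mulr_suml.
Qed.

Lemma inner_combr w (c : {perm T} -> R) (F : {perm T} -> weighting R T k) :
  inner w [ffun e => \sum_p c p * F p e] = \sum_p c p * inner w (F p).
Proof.
rewrite /inner; under eq_bigr => e _ do rewrite ffunE mulr_sumr.
rewrite exchange_big; apply: eq_bigr => p _ /=; rewrite mulr_sumr.
by apply: eq_bigr => e _; rewrite mulrCA.
Qed.

Lemma inner_permw p w u : inner (permw p w) u = inner w (permw p^-1%g u).
Proof.
rewrite /inner (reindex _ (onW_bij _ (kact_bij k p))) /=.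
by apply: eq_bigr => e _; rewrite !permwE kactK invgK.
Qed.

Lemma wtot_permw p w : wtot (permw p w) = wtot w.
Proof.
rewrite /wtot (reindex _ (onW_bij _ (kact_bij k p))) /=.
by apply: eq_bigr => e _; rewrite !permwE kactK.
Qed.

Lemma inner_eq0 w : inner w w = 0 -> w = 0.
Proof.
move=> /eqP; rewrite psumr_eq0 => [/allP w0|e _]; last by rewrite -expr2 sqr_ge0.
apply/ffunP => e; rewrite ffunE; apply/eqP.
by have := w0 e (mem_index_enum e); rewrite mulf_eq0 orbb.
Qed.

Lemma disc_eq0P w u :
  disc w u = 0 <->
  forall p, inner (permw p w) u = dens w * dens u * ('C(#|T|, k))%:R.
Proof.
split=> [d0 p|inn].
  apply/eqP; rewrite -subr_eq0 -normr_le0 -[X in _ <= X]d0.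
  rewrite /disc; exact: (le_bigmax 0 (fun p => `|inner (permw p w) u -
    dens w * dens u * ('C(#|T|, k))%:R|)).
apply: (big_ind (fun z => z = 0)) => //= [a b -> ->|p _]; first exact: maxxx.
by rewrite inn subrr normr0.
Qed.

End Weightings.

(** * Products over disjoint pairs and the vanishing of W-vector components *)

Section PairProducts.
Variables (R : realFieldType) (T : finType).
Implicit Types (S A : {set T}) (f : {set T} -> R) (ps : seq (T * T)).

(** Translates of [phi] take this form. A list of pairs over arbitrary sets lets the recursion of
    [Wv] consume one pair at a time. *)
Definition pair_prod ps A : R :=
  \prod_(ab <- ps) ((ab.1 \in A)%:R - (ab.2 \in A)%:R).

Definition pair_support ps : seq T := flatten [seq [:: ab.1; ab.2] | ab <- ps].

Lemma pair_prod_eq ps A (B : {set T}) :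
  {in pair_support ps, A =i B} -> pair_prod ps A = pair_prod ps B.
Proof.
move=> AB; apply: eq_big_seq => -[a b] abps /=.
by rewrite !AB //; apply/flatten_mapP; exists (a, b); rewrite // !inE eqxx ?orbT.
Qed.

Lemma pair_support_cons a b ps :
  pair_support ((a, b) :: ps) = [:: a, b & pair_support ps].
Proof. by []. Qed.

Lemma pair_support_inj : injective pair_support.
Proof.
elim=> [|[a b] s IHs] [|[c d] t] //= [-> -> st].
by rewrite (IHs t).
Qed.

Lemma Wv_ge0 m S f i : 0 <= Wv m S f i.
Proof.
elim: m S f i => [|m IHm] S f [|i] //=; rewrite ?divr_ge0 ?ler0n ?normr_ge0 //.
by do 2 apply: sumr_ge0 => ? _.
Qed.

(** A sum of nonnegative terms vanishes only termwise, and two elements in [S] make the denominator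
    of the average nonzero. *)
Lemma WvS_eq0 m S f i : (1 < #|S|)%N ->
  Wv m.+1 S f i.+1 = 0 <->
  forall a b, a \in S -> b \in S -> b != a ->
    Wv m (S :\ a :\ b) (fun e => f (a |: e) - f (b |: e)) i = 0.
Proof.
move=> S1 /=; set c : R := _%:R; have c0 : c != 0.
  by rewrite pnatr_eq0 -lt0n muln_gt0 subn_gt0 S1 (ltnW S1).
have ge0 a b := Wv_ge0 m (S :\ a :\ b) (fun e => f (a |: e) - f (b |: e)) i.
split=> [/eqP|W0].
  rewrite mulf_eq0 invr_eq0 (negPf c0) orbF psumr_eq0 => [/allP W0|a _]; last first.
    by apply: sumr_ge0 => b _.
  move=> a b aS bS ba; have /implyP/(_ aS) := W0 a (mem_index_enum a).
  rewrite psumr_eq0 // => /allP/(_ b (mem_index_enum b))/implyP.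
  by rewrite bS ba => /(_ isT)/eqP.
rewrite big1 ?mul0r // => a aS; rewrite big1 // => b /andP[bS ba].
exact: W0.
Qed.

Lemma card_setD11 S a b : a \in S -> b \in S -> b != a ->
  #|S| = #|S :\ a :\ b|.+2.
Proof.
move=> aS bS ba; rewrite (cardsD1 a) aS add1n; congr _.+1.
by rewrite (cardsD1 b) !inE ba bS.
Qed.

Lemma sum_sets_splitting_pair m S a b (G : {set T} -> R) : a \in S -> b != a ->
  \sum_(A : {set T} | [&& A \subset S, #|A| == m.+1, a \in A & b \notin A]) G A =
  \sum_(A : {set T} | (A \subset S :\ a :\ b) && (#|A| == m)) G (a |: A).
Proof.
move=> aS ba; rewrite (reindex_onto (fun A => a |: A) (fun A => A :\ a)) /=.
  apply: eq_bigl => A; rewrite !inE eqxx (negPf ba) /=.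
  rewrite !subsetD1 subUset sub1set aS /=.
  case aA: (a \in A); last first.
    rewrite cardsU1 aA add1n eqSS setU1K ?aA // eqxx.
    by case: (A \subset S); rewrite ?andbT //= andbC.
  rewrite !andbF; apply/negbTE/negP => /andP[_ /eqP /setP/(_ a)].
  by rewrite !inE eqxx aA.
by move=> A /and4P[_ _ aA _]; rewrite setD1K.
Qed.

(** One level of the recursion: the factor for [(a, b)] kills every set containing both or neither
    of the two. Deleting the one that is present leaves an m-subset avoiding both, and the other
    factors do not notice. *)
Lemma sum_mul_pair_diff m S f a b ps :
  a \in S -> b \in S -> b != a ->
  a \notin pair_support ps -> b \notin pair_support ps ->
  \sum_(A : {set T} | (A \subset S) && (#|A| == m.+1))
     f A * pair_prod ((a, b) :: ps) A =
  \sum_(A : {set T} | (A \subset S :\ a :\ b) && (#|A| == m))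
     (f (a |: A) - f (b |: A)) * pair_prod ps A.
Proof.
move=> aS bS ba aps bps.
pose G A := f A * pair_prod ps A.
transitivity (
  \sum_(A : {set T} | [&& A \subset S, #|A| == m.+1, a \in A & b \notin A]) G A -
  \sum_(A : {set T} | [&& A \subset S, #|A| == m.+1, b \in A & a \notin A]) G A).
  rewrite big_mkcond [X in X - _]big_mkcond [X in _ - X]big_mkcond -sumrB.
  apply: eq_bigr => A _; rewrite /pair_prod big_cons /= -/(pair_prod _ _) /G.
  case: (A \subset S); case: (#|A| == m.+1); case: (a \in A); case: (b \in A) => /=;
    by rewrite ?subrr ?subr0 ?sub0r ?mul0r ?mulr0 ?mul1r ?mulN1r ?mulrN.
rewrite !sum_sets_splitting_pair // 1?eq_sym //.
have -> : S :\ b :\ a = S :\ a :\ b by rewrite !setDDl setUC.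
rewrite -sumrB; apply: eq_bigr => A _; rewrite /G mulrBl.
congr (_ * _ - _ * _); apply: pair_prod_eq => c cps; rewrite !inE.
  by case: eqP cps aps => // -> ->.
by case: eqP cps bps => // -> ->.
Qed.

Lemma sum_mul_pair_prod_nil (P : pred {set T}) f :
  \sum_(A | P A) f A * pair_prod [::] A = \sum_(A | P A) f A.
Proof. by apply: eq_bigr => A _; rewrite /pair_prod big_nil mulr1. Qed.

Lemma Wv0_eq0 m S f : (2 * m <= #|S|)%N ->
  Wv m S f 0 = 0 <-> \sum_(A : {set T} | (A \subset S) && (#|A| == m)) f A = 0.
Proof.
move=> Sm; have C0 : ('C(#|S|, m))%:R != 0 :> R.
  by rewrite pnatr_eq0 -lt0n bin_gt0 (leq_trans _ Sm) // leq_pmull.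
have -> : Wv m S f 0 =
    `|\sum_(A : {set T} | (A \subset S) && (#|A| == m)) f A| / 'C(#|S|, m)%:R.
  by case: (m).
split=> [/eqP|->]; last by rewrite normr0 mul0r.
by rewrite mulf_eq0 invr_eq0 (negPf C0) orbF normr_eq0 => /eqP.
Qed.

(** Each recursive level of [Wv] supplies one pair, by [WvS_eq0] and [sum_mul_pair_diff]. Removing
    two points from [S] while [m] drops by one preserves the size bound. *)
Lemma Wv_eq0P m S f i : (i <= m)%N -> (2 * m <= #|S|)%N ->
  Wv m S f i = 0 <->
  forall ps, size ps = i -> uniq (pair_support ps) ->
    {subset pair_support ps <= S} ->
    \sum_(A : {set T} | (A \subset S) && (#|A| == m)) f A * pair_prod ps A = 0.
Proof.
elim: m S f i => [|m IHm] S f [|i] // im Sm.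
1,2: apply: iff_trans (Wv0_eq0 f Sm) _; rewrite -sum_mul_pair_prod_nil.
1,2: by split=> [W0 [|//] _ _ _ //|W0]; apply: W0.
have S1 : (1 < #|S|)%N by rewrite (leq_trans _ Sm) // mulnS.
apply: iff_trans (WvS_eq0 _ _ _ S1) _.
have Sm' a b : a \in S -> b \in S -> b != a -> (2 * m <= #|S :\ a :\ b|)%N.
  by move=> aS bS ba; move: Sm; rewrite (card_setD11 aS bS ba) mulnS.
split=> W0 => [[//|[a b] ps] [ips]|a b aS bS ba].
  rewrite pair_support_cons /= inE negb_or => /and3P[/andP[ab aps] bps ups] sub.
  have aS : a \in S by rewrite sub ?inE ?eqxx.
  have bS : b \in S by rewrite sub ?inE ?eqxx ?orbT.
  rewrite eq_sym in ab; rewrite sum_mul_pair_diff //.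
  have /(IHm _ _ _ im (Sm' _ _ aS bS ab)) := W0 a b aS bS ab; apply=> //.
  move=> c cps; rewrite !inE sub ?inE ?cps ?orbT // andbT.
  by apply/andP; split; [apply: contraNneq bps => <- | apply: contraNneq aps => <-].
apply/(IHm _ _ _ im (Sm' _ _ aS bS ba)) => ps ips ups sub.
have aps : a \notin pair_support ps by apply/negP => /sub; rewrite !inE eqxx andbF.
have bps : b \notin pair_support ps by apply/negP => /sub; rewrite !inE eqxx.
rewrite -sum_mul_pair_diff //; apply: W0; rewrite ?pair_support_cons /= ?ips //.
  by rewrite inE negb_or eq_sym ba aps bps ups.
by move=> c; rewrite !inE => /or3P[/eqP->|/eqP->|/sub] //; rewrite !inE => /and3P[].
Qed.

(** Exchanging an element of [A :\: B] for one of [B :\: A] preserves [f] and brings [A] closer to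
    [B]. *)
Lemma fun_sets_const m S f :
  (forall a b (e : {set T}), a \in S -> b \in S -> b != a -> e \subset S :\ a :\ b ->
     #|e| = m -> f (a |: e) = f (b |: e)) ->
  forall A B : {set T}, A \subset S -> B \subset S ->
    #|A| = m.+1 -> #|B| = m.+1 -> f A = f B.
Proof.
move=> fex A B; move En: #|A :\: B| => n; elim: n A En => [|n IHn] A En AS BS Am Bm.
  congr f; apply/eqP; rewrite eqEcard Am Bm leqnn andbT -setD_eq0.
  by rewrite -cards_eq0 En.
have [a aAB] : exists a, a \in A :\: B by apply/card_gt0P; rewrite En.
have [b bBA] : exists b, b \in B :\: A.
  apply/card_gt0P; rewrite cardsD setIC -(eqP (_ : #|A| == #|B|)) ?Am ?Bm // -Am.
  by rewrite -cardsD En.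
move: (aAB) (bBA); rewrite !inE => /andP[aB aA] /andP[bA bB].
have ba : b != a by apply: contraNneq bA => ->.
have aS := subsetP AS _ aA; have bS := subsetP BS _ bB.
have Am' : #|A :\ a| = m by move: Am; rewrite (cardsD1 a) aA => -[].
have bAa : b \notin A :\ a by rewrite !inE (negPf bA) andbF.
transitivity (f (b |: (A :\ a))).
  rewrite -{1}(setD1K aA); apply: fex => //.
  by rewrite subsetD1 bAa andbT setSD.
apply: IHn => //; last by rewrite cardsU1 bAa Am'.
- apply: succn_inj; rewrite -En [in RHS](cardsD1 a) aAB; congr _.+1.
  apply: eq_card => c; rewrite !inE; case: (eqVneq c b) => [->|_] /=.
    by rewrite bB andbF.
  by rewrite andbCA.
- by rewrite subUset sub1set bS (subset_trans (subsetDl _ _)).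
Qed.

(** By induction on [m] all differences [f (a |: e) - f (b |: e)] vanish, so [f] is constant on the
    sets in question. Component 0 then makes the constant zero. *)
Lemma Wv_all_eq0 m S f : (2 * m <= #|S|)%N ->
  (forall i, (i <= m)%N -> Wv m S f i = 0) ->
  forall A : {set T}, A \subset S -> #|A| = m -> f A = 0.
Proof.
elim: m S f => [|m IHm] S f Sm W0 A AS Am.
  have /(Wv0_eq0 f Sm) := W0 0 (leqnn _).
  rewrite (bigD1 A) ?AS ?Am //= big1 ?addr0 => [|B]; last first.
    by move/cards0_eq: Am => ->; rewrite cards_eq0 andbC; case: eqP; rewrite ?andbF.
  exact: id.
have fAB (B : {set T}) : (B \subset S) && (#|B| == m.+1) -> f B = f A.
  case/andP=> BS /eqP Bm; apply: (fun_sets_const (S := S) (m := m)) => //.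
  move=> a b e aS bS ba eS em; apply/eqP; rewrite -subr_eq0; apply/eqP.
  apply: (IHm (S :\ a :\ b) (fun e => f (a |: e) - f (b |: e))) => // [|i im].
    by move: Sm; rewrite (card_setD11 aS bS ba) mulnS.
  have /WvS_eq0 := W0 i.+1 im; apply => //.
  by rewrite (leq_trans _ Sm) // mulnS.
have /(Wv0_eq0 f Sm) := W0 0 (leq0n _).
rewrite (eq_bigr (fun=> f A)) // sumr_const => /eqP; rewrite mulrn_eq0.
case/orP=> [|/eqP //].
by rewrite eqn0Ngt => /card_gt0P; case; exists A; rewrite unfold_in AS Am eqxx.
Qed.

End PairProducts.

(** * Counting lemmas and sums over k-sets *)

Lemma cardsI_sum (T : finType) (A B : {set T}) :
  #|A :&: B| = (\sum_(c in B) (c \in A))%N.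
Proof.
rewrite setIC -sum1_card.
under eq_bigl => c do rewrite inE.
by rewrite big_mkcondr; apply: eq_bigr => c _; case: (c \in A).
Qed.

Lemma cardsI_set2 (T : finType) (A : {set T}) a b : a != b ->
  #|A :&: [set a; b]| = ((a \in A) + (b \in A))%N.
Proof. by move=> ab; rewrite cardsI_sum big_setU1 ?inE //= big_set1. Qed.

Lemma card_ltn_ord k i : (i <= k)%N -> #|[set j : 'I_k | (j < i)%N]| = i.
Proof.
move=> ik; have inj : injective (widen_ord ik) by move=> a b /(congr1 val) ab; apply/val_inj.
rewrite -[RHS]card_ord -(card_imset _ inj).
apply: eq_card => j; rewrite inE; apply/idP/imsetP => [ji|[l _ ->]] //=.
by exists (Ordinal ji) => //; apply: val_inj.
Qed.

Lemma wext_val (R : realFieldType) (T : finType) k (w : weighting R T k) e :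
  wext w (val e) = w e.
Proof. by rewrite /wext valK. Qed.

Lemma sum_kset (R : nmodType) (T : finType) k (F : {set T} -> R) :
  \sum_(e : kset T k) F (val e) = \sum_(A : {set T} | #|A| == k) F A.
Proof.
rewrite [RHS](reindex_omap (val : kset T k -> {set T}) insub) /=.
  by apply: eq_bigl => e; rewrite valK eqxx (valP e).
by move=> A Ak; rewrite insubT.
Qed.

(** * The functions [phi i], their translates and their symmetries *)

Section Phi.
Variables (R : realFieldType) (T : finType) (k : nat) (x y : 'I_k -> T).
Hypotheses (kT : (2 * k <= #|T|)%N) (injx : injective x) (injy : injective y).
Hypothesis (xy : forall i j, x i != y j).
Implicit Types (w u v : weighting R T k) (p q : {perm T}) (i j : nat).

Local Notation phi := (phi (R := R) x y).

Lemma phiE i e :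
  phi i e = \prod_(j : 'I_k | (j < i)%N) ((x j \in val e)%:R - (y j \in val e)%:R).
Proof.
rewrite ffunE; case: ifP => [/forallP one|/negbT].
  rewrite cardsI_sum big_imset => [|j l _ _ /injy //] /=.
  under eq_bigl => j do rewrite inE.
  rewrite -prodrXr; apply: eq_bigr => j ji.
  have := one j; rewrite ji /= cardsI_set2 //.
  by case: (x j \in _); case: (y j \in _) => //= _; rewrite ?subr0 ?sub0r.
case/forallPn => j; rewrite negb_imply cardsI_set2 // => /andP[ji none].
rewrite (bigD1 j) //=; move: none.
by case: (x j \in _); case: (y j \in _) => //= _; rewrite subrr mul0r.
Qed.

Definition phi_pairs p i : seq (T * T) :=
  [seq (p (x j), p (y j)) | j : 'I_k <- enum 'I_k & (j < i)%N].

Lemma permw_phiE p i e : permw p (phi i) e = pair_prod R (phi_pairs p i) (val e).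
Proof.
rewrite permwE phiE /pair_prod big_map big_filter big_enum_cond /=.
by apply: eq_bigr => j _; rewrite !mem_kact invgK.
Qed.

Lemma size_phi_pairs p i : (i <= k)%N -> size (phi_pairs p i) = i.
Proof.
move=> ik; rewrite size_map -sum1_size big_filter big_enum_cond /= sum1dep_card.
exact: card_ltn_ord.
Qed.

Lemma pair_support_map p ps :
  pair_support [seq (p ab.1, p ab.2) | ab <- ps] = map p (pair_support ps).
Proof. by elim: ps => // -[a b] ps IHps; rewrite map_cons !pair_support_cons IHps. Qed.

Lemma phi_pairs_perm p i :
  phi_pairs p i = [seq (p ab.1, p ab.2) | ab <- phi_pairs 1%g i].
Proof. by rewrite -map_comp; apply: eq_map => j /=; rewrite !perm1. Qed.

Lemma uniq_phi_pairs p i : uniq (pair_support (phi_pairs p i)).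
Proof.
rewrite phi_pairs_perm pair_support_map (map_inj_uniq perm_inj) /phi_pairs.
have : uniq [seq j : 'I_k <- enum 'I_k | (j < i)%N] by rewrite filter_uniq ?enum_uniq.
elim: {p i}(filter _ _) => // j s IHs; rewrite cons_uniq => /andP[js us].
rewrite map_cons pair_support_cons !cons_uniq !perm1 inE negb_or xy IHs // andbT /=.
apply/andP; split; apply/flatten_mapP => -[_ /mapP[l ls ->]] /=; rewrite !inE !perm1.
  by rewrite (negPf (xy _ _)) orbF (inj_eq injx) => /eqP jl; rewrite jl ls in js.
by rewrite eq_sym (negPf (xy _ _)) (inj_eq injy) => /eqP jl; rewrite jl ls in js.
Qed.

(** Any two lists of [i] disjoint pairs differ by a permutation of [T]. Hence the test functions of
    [Wv_eq0P] are exactly the translates of [phi i]. *)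
Lemma ex_phi_pairs i ps : (i <= k)%N -> size ps = i -> uniq (pair_support ps) ->
  exists p, phi_pairs p i = ps.
Proof.
move=> ik ips ups.
have szs (qs : seq (T * T)) : size (pair_support qs) = (2 * size qs)%N.
  by elim: qs => // -[a b] qs IHqs; rewrite pair_support_cons mulnS /= IHqs.
have [|p Ep] := perm_extends_seq (uniq_phi_pairs 1%g i) ups.
  by rewrite !szs size_phi_pairs // ips.
by exists p; apply: pair_support_inj; rewrite phi_pairs_perm pair_support_map.
Qed.

Lemma permw_swap_phi i (j : 'I_k) : (j < i)%N ->
  permw (tperm (x j) (y j)) (phi i) = - phi i.
Proof.
move=> ji; apply/ffunP => e; rewrite permwE [RHS]ffunE !phiE tpermV.
rewrite !(bigD1 (P := fun j : 'I_k => (j < i)%N) j) //= -mulNr opprB.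
rewrite !mem_kact tpermV tpermL tpermR.
congr (_ * _); apply: eq_bigr => l /andP[_ lj]; rewrite !mem_kact tpermV.
by rewrite !tpermD // ?(inj_eq injx) ?(inj_eq injy) ?xy // 1?eq_sym ?xy.
Qed.

Lemma permw_tperm_phi i a b :
  (forall j : 'I_k, (j < i)%N -> [/\ a != x j, a != y j, b != x j & b != y j]) ->
  permw (tperm a b) (phi i) = phi i.
Proof.
move=> out; apply/ffunP => e; rewrite permwE !phiE tpermV.
by apply: eq_bigr => l /out[? ? ? ?]; rewrite !mem_kact tpermV !tpermD.
Qed.

Lemma inV_permw_phi p i : inV x y i (permw p (phi i)).
Proof.
exists (fun q => (q == p)%:R); apply/ffunP => e; rewrite [RHS]ffunE.
by rewrite (bigD1 p) //= eqxx mul1r big1 ?addr0 // => q /negPf ->; rewrite mul0r.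
Qed.

Lemma inVperpP w i :
  inVperp x y i w <-> forall p, inner w (permw p (phi i)) = 0.
Proof.
split=> [w0 p|w0 v [c ->]]; first exact/w0/inV_permw_phi.
by rewrite inner_combr big1 // => p _; rewrite w0 mulr0.
Qed.

Lemma inVperp_permw p i w : inVperp x y i w -> inVperp x y i (permw p w).
Proof.
by move=> /inVperpP w0; apply/inVperpP => q; rewrite inner_permw permwM.
Qed.

(** * W-vector components as orthogonality conditions, and spanning *)

Lemma Wvec_eq0P w i : (i <= k)%N -> Wvec w i = 0 <-> inVperp x y i w.
Proof.
move=> ik; have kT' : (2 * k <= #|[set: T]|)%N by rewrite cardsT.
apply: iff_trans (Wv_eq0P _ ik kT') _; apply: iff_trans _ (iff_sym (inVperpP _ _)).
have innE p : inner w (permw p (phi i)) =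
    \sum_(A : {set T} | (A \subset [set: T]) && (#|A| == k))
      wext w A * pair_prod R (phi_pairs p i) A.
  under [RHS]eq_bigl => A do rewrite subsetT.
  rewrite -(sum_kset k (fun A : {set T} => wext w A * pair_prod R (phi_pairs p i) A)).
  by apply: eq_bigr => e _; rewrite permw_phiE wext_val.
split=> [w0 p|w0 ps ips ups _].
  rewrite innE; apply: w0; rewrite ?size_phi_pairs ?uniq_phi_pairs // => c _.
  by rewrite inE.
by have [p <-] := ex_phi_pairs ik ips ups; rewrite -innE.
Qed.

Lemma perp_all_eq0 w : (forall i, (i <= k)%N -> inVperp x y i w) -> w = 0.
Proof.
move=> w0; apply/ffunP => e; rewrite ffunE -wext_val.
apply: (@Wv_all_eq0 _ _ k [set: T]); rewrite ?cardsT ?subsetT //; last exact/eqP/(valP e).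
by move=> i ik; apply/(Wvec_eq0P w ik)/w0.
Qed.

Lemma inV_span w : exists u : 'I_k.+1 -> weighting R T k,
  (forall i : 'I_k.+1, inV x y i (u i)) /\ w = \sum_(i < k.+1) u i.
Proof.
have [|c wE] := @span_of_trivial_annihilator R _ _
  (fun (ip : 'I_k.+1 * {perm T}) (e : kset T k) => permw ip.2 (phi ip.1) e) _ w.
  move=> v v0 e; have -> : v e = [ffun e => v e] e by rewrite ffunE.
  rewrite (perp_all_eq0 (w := [ffun e => v e])) ?ffunE // => i ik.
  apply/inVperpP => p; rewrite -[RHS](v0 (Ordinal (ik : (i < k.+1)%N), p)).
  by apply: eq_bigr => f _; rewrite ffunE.
exists (fun i : 'I_k.+1 => [ffun e => \sum_p c (i, p) * permw p (phi i) e]).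
split=> [i|]; first by exists (fun p => c (i, p)).
apply/ffunP => e; rewrite wE sum_ffunE.
under [RHS]eq_bigr => i _ do rewrite ffunE.
by rewrite pair_bigA; apply: eq_bigr => -[].
Qed.

(** * Orthogonality of the spaces [V_i] *)

(** [B] collects the elements chosen while the factors of [ps] are expanded one by one; each
    expansion moves at most one unit from [size ps] to the size of [B], so the bound survives. *)
Lemma sum_subset_phi (B : {set T}) j ps : (j <= k)%N -> (size ps + #|B| < j)%N ->
  \sum_(e : kset T k) (B \subset val e)%:R * pair_prod R ps (val e) * phi j e = 0.
Proof.
move=> jk; elim: ps B => [|[a b] ps IHps] B Bj.
  have [l lj /andP[lB1 lB2]] : exists2 l : 'I_k, (l < j)%N & (x l \notin B) && (y l \notin B).
    apply/exists_inP; apply: contraTT Bj => /exists_inPn Bmeet.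
    rewrite -leqNgt add0n -{1}(card_ltn_ord jk).
    (* Pigeonhole: if all of the first [j] pairs met [B], then [f] would inject their indices into
       [B], which has fewer than [j] elements. *)
    pose f l := if x l \in B then x l else y l.
    rewrite -(card_imset (f := f)) => [|a b]; last first.
      rewrite /f; case: ifP => _; case: ifP => _; [exact: injx| | |exact: injy].
        by move/eqP; rewrite (negPf (xy _ _)).
      by move/esym/eqP; rewrite (negPf (xy _ _)).
    apply/subset_leq_card/subsetP => c /imsetP[l]; rewrite inE => /Bmeet + ->.
    by rewrite negb_and !negbK /f; case: ifP.
  (* Reindex by the swap of the pair missing [B]: it preserves containment of [B] and negates
     [phi j]. *)
  set S := \sum_e _; have : S = - S.
    rewrite {1}/S (reindex _ (onW_bij _ (kact_bij k (tperm (x l) (y l))))) /= -sumrN.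
    apply: eq_bigr => e _; rewrite /pair_prod !big_nil !mulr1.
    have := permw_swap_phi lj => /ffunP/(_ e); rewrite permwE [RHS]ffunE tpermV => ->.
    rewrite mulrN; congr (- (_ %:R * _)); congr (nat_of_bool _).
    apply/subsetP/subsetP => Be c cB; have := Be c cB; rewrite mem_kact tpermV tpermD //;
      by apply: contraTneq cB => <-.
  by move/esym/eqP; rewrite eqNr => /eqP.
have step c : (size ps + #|c |: B| < j)%N.
  by rewrite (leq_ltn_trans _ Bj) //= addSnnS leq_add2l cardsU1; case: (c \in B).
pose F c := \sum_(e : kset T k)
  (c |: B \subset val e)%:R * pair_prod R ps (val e) * phi j e.
transitivity (F a - F b); last by rewrite /F !IHps // subrr.
rewrite /F -sumrB; apply: eq_bigr => e _; rewrite -mulrBl; congr (_ * _).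
rewrite /pair_prod big_cons /= mulrA !subUset !sub1set -mulrBl; congr (_ * _).
by case: (B \subset _); rewrite ?andbT ?andbF ?mul1r ?mul0r ?subr0.
Qed.

Lemma inner_phi_lt i j p q : (i < j <= k)%N ->
  inner (permw p (phi i)) (permw q (phi j)) = 0.
Proof.
case/andP=> ij jk; rewrite innerC inner_permw permwM innerC.
rewrite -[RHS](@sum_subset_phi set0 j (phi_pairs (p * q^-1)%g i)) //.
  by apply: eq_bigr => e _; rewrite permw_phiE sub0set mul1r.
by rewrite cards0 addn0 size_phi_pairs // (leq_trans (ltnW ij)).
Qed.

Lemma inV_perp i j u : (i <= k)%N -> (j <= k)%N -> i != j ->
  inV x y i u -> inVperp x y j u.
Proof.
move=> ik jk ij [c ->]; apply/inVperpP => q; rewrite innerC inner_combr.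
apply: big1 => p _; move: ij; rewrite neq_ltn => /orP[] ij.
  by rewrite innerC inner_phi_lt ?ij ?mulr0.
by rewrite inner_phi_lt ?ij ?mulr0.
Qed.

Lemma inner_sumV (u : 'I_k.+1 -> weighting R T k) (i : 'I_k.+1) v :
  (forall h : 'I_k.+1, inV x y h (u h)) -> inV x y i v ->
  inner (\sum_(h < k.+1) u h) v = inner (u i) v.
Proof.
move=> uV vi; rewrite inner_suml (bigD1 i) //= big1 ?addr0 // => h hi.
by apply: (inV_perp (i := h) (j := i)) => //; rewrite -ltnS.
Qed.

(** Pairing the sum with [u i] itself leaves only the square norm of [u i]. Both directness of the
    sum and the W-vector criterion follow from this. *)
Lemma inVperp_sumV (u : 'I_k.+1 -> weighting R T k) (i : 'I_k.+1) :
  (forall h : 'I_k.+1, inV x y h (u h)) ->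
  inVperp x y i (\sum_(h < k.+1) u h) <-> u i = 0.
Proof.
move=> uV; split=> [w0|u0 v vi]; last first.
  by rewrite (inner_sumV (i := i)) // u0 /inner big1 // => e _; rewrite ffunE mul0r.
by apply: inner_eq0; rewrite -(inner_sumV (i := i)) // w0.
Qed.

(** * Discrepancy and the spaces [V_i] *)

(** Swapping the first pair negates [phi i] but keeps its total. *)
Lemma wtot_phi i : (0 < i <= k)%N -> wtot (phi i) = 0.
Proof.
case/andP=> i0 ik; pose j : 'I_k := Ordinal (leq_trans i0 ik).
have : wtot (permw (tperm (x j) (y j)) (phi i)) = wtot (phi i) by rewrite wtot_permw.
rewrite permw_swap_phi // /wtot; under eq_bigr => e _ do rewrite ffunE.
by rewrite sumrN => /eqP; rewrite eqNr => /eqP.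
Qed.

Lemma wtot_inV i u : (0 < i <= k)%N -> inV x y i u -> wtot u = 0.
Proof.
move=> ik [c ->]; rewrite /wtot.
under eq_bigr => e _ do rewrite ffunE.
rewrite exchange_big big1 //= => p _; rewrite -mulr_sumr.
by rewrite -/(wtot (permw p (phi i))) wtot_permw wtot_phi ?mulr0.
Qed.

Lemma disc_phi_eq0P i w : (0 < i <= k)%N ->
  disc w (phi i) = 0 <-> inVperp x y i w.
Proof.
move=> ik; apply: iff_trans (disc_eq0P _ _) _; apply: iff_trans _ (iff_sym (inVperpP _ _)).
rewrite {2}/dens wtot_phi // mul0r mulr0 mul0r.
by split=> w0 p; rewrite ?inner_permw -?[permw p _]invgK; [rewrite -[p]invgK -inner_permw|].
Qed.

Lemma disc_inV i j u w : (i <= k)%N -> (j <= k)%N -> i != j ->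
  inV x y i u -> inV x y j w -> disc u w = 0.
Proof.
move=> ik jk ij ui wj; apply/disc_eq0P => p.
rewrite (inVperp_permw p (inV_perp ik jk ij ui)) //.
suff : dens u * dens w = 0 by move=> ->; rewrite mul0r.
(* Since [i] and [j] differ, at least one is positive, and the weighting in that space has density
   zero. *)
case: (posnP i) ij => [-> |i0 _]; last by rewrite /dens (wtot_inV (i := i)) ?i0 ?mul0r.
by rewrite eq_sym -lt0n => j0; rewrite /dens (wtot_inV (i := j) (u := w)) ?j0 ?mul0r ?mulr0.
Qed.

(** * Recovering [phi i] from a weighting by symmetrization *)

Lemma phi_neq0_swap i e : phi i e != 0 -> forall j : 'I_k, (j < i)%N ->
  (y j \in val e) = (x j \notin val e).
Proof.
rewrite phiE => /prodf_neq0 nz j /nz.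
by case: (x j \in _); case: (y j \in _); rewrite ?subrr ?eqxx.
Qed.

(* Any two k-sets in the support of phi i are linked by pair swaps and by
   transpositions avoiding the first i pairs. *)
Lemma phi_proportional i w :
  (forall j : 'I_k, (j < i)%N -> permw (tperm (x j) (y j)) w = - w) ->
  (forall a b, (forall j : 'I_k, (j < i)%N ->
      [/\ a != x j, a != y j, b != x j & b != y j]) -> permw (tperm a b) w = w) ->
  forall e f, w e * phi i f = w f * phi i e.
Proof.
move=> wswap wout.
(* Off the support of [phi i] some pair lies wholly inside or wholly outside [e], so its swap fixes
   [e] yet negates [w]. *)
have act0 e : phi i e = 0 -> w e = 0.
  move/eqP; rewrite phiE => /prodf_eq0[j ji].
  rewrite subr_eq0 => E; have /ffunP/(_ e) := wswap j ji.
  rewrite permwE ffunE tpermV kact_tperm_fix.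
    by move/esym/eqP; rewrite eqNr => /eqP.
  by move: E; rewrite eqr_nat; case: (x j \in _); case: (y j \in _).
move=> e f; have [e0|e1] := eqVneq (phi i e) 0; first by rewrite e0 act0 // mul0r mulr0.
have [f0|f1] := eqVneq (phi i f) 0; first by rewrite f0 (act0 f) // mul0r mulr0.
move En: #|val e :\: val f| => n; elim: n e En e1 => [|n IHn] e En e1.
  suff -> : e = f by [].
  apply/val_inj/eqP; rewrite eqEcard (eqP (valP e)) (eqP (valP f)) leqnn andbT.
  by rewrite -setD_eq0 -cards_eq0 En.
(* The inductive step: a transposition that scales [w] and [phi i] by the same nonzero [s] and
   trades an element of [e] outside [f] for one of [f] outside [e]. *)
have move_pair a b (s : R) : s != 0 -> permw (tperm a b) w = [ffun e => s * w e] ->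
    permw (tperm a b) (phi i) = [ffun e => s * phi i e] ->
    a \in val e -> a \notin val f -> b \notin val e -> b \in val f ->
    w e * phi i f = w f * phi i e.
  move=> s0 /ffunP/(_ e); rewrite permwE [RHS]ffunE tpermV => we.
  move=> /ffunP/(_ e); rewrite permwE [RHS]ffunE tpermV => phie ae af be bf.
  apply: (mulfI s0); rewrite mulrA -we [RHS]mulrCA -phie.
  apply: IHn; last by rewrite phie mulf_neq0.
  apply: succn_inj; rewrite -En [in RHS](cardsD1 a) !inE ae af; congr _.+1.
  apply: eq_card => c; rewrite !inE mem_kact tpermV.
  case: tpermP => [->|->|/eqP ca _]; rewrite ?eqxx ?af ?bf ?(negPf be) ?andbF //=.
  by rewrite ca.
have [a] : exists a, a \in val e :\: val f by apply/card_gt0P; rewrite En.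
rewrite inE => /andP[af ae].
have neg1 : -1 != 0 :> R by rewrite oppr_eq0 oner_eq0.
have opp (v : weighting R T k) : - v = [ffun e => -1 * v e].
  by apply/ffunP => g; rewrite !ffunE mulN1r.
have one (v : weighting R T k) : v = [ffun e => 1 * v e].
  by apply/ffunP => g; rewrite !ffunE mul1r.
have esw := phi_neq0_swap e1; have fsw := phi_neq0_swap f1.
have [/existsP[j /and3P[ji ej fj]]|/existsPn same] := boolP [exists j : 'I_k,
    [&& (j < i)%N, (x j \in val e) & (x j \notin val f)]].
  apply: (move_pair (x j) (y j) (-1)) => //; rewrite -?opp ?wswap ?permw_swap_phi //.
    by rewrite esw ?ej.
  by rewrite fsw.
have [/existsP[j /and3P[ji ej fj]]|/existsPn same'] := boolP [exists j : 'I_k,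
    [&& (j < i)%N, (x j \notin val e) & (x j \in val f)]].
  apply: (move_pair (y j) (x j) (-1)) => //; rewrite -?opp 1?tpermC ?wswap ?permw_swap_phi //.
    by rewrite esw.
  by rewrite fsw ?fj.
(* Now [e] and [f] agree on the first [i] pairs, so elements in which they differ avoid these pairs
   and may be transposed with [s = 1]. *)
have xsame (j : 'I_k) : (j < i)%N -> (x j \in val e) = (x j \in val f).
  move=> ji; move: (same j) (same' j); rewrite ji /=.
  by case: (x j \in _); case: (x j \in _).
have ysame (j : 'I_k) : (j < i)%N -> (y j \in val e) = (y j \in val f).
  by move=> ji; rewrite esw ?fsw ?xsame.
have [b] : exists b, b \in val f :\: val e.
  have cef : #|val f| = #|val e| by rewrite (eqP (valP e)) (eqP (valP f)).
  by apply/card_gt0P; rewrite cardsD setIC cef -cardsD En.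
rewrite inE => /andP[be bf].
have out c : (c \in val e) != (c \in val f) ->
    forall j : 'I_k, (j < i)%N -> (c != x j) /\ (c != y j).
  move=> cef j ji; split; apply: contraNneq cef => ->; first by rewrite xsame.
  by rewrite ysame.
have outab (j : 'I_k) : (j < i)%N -> [/\ a != x j, a != y j, b != x j & b != y j].
  move=> ji; have [|ax ay] := out a _ j ji; first by rewrite ae (negPf af).
  have [|bx by_] := out b _ j ji; first by rewrite (negPf be) bf.
  by split.
by apply: (move_pair a b 1); rewrite ?oner_eq0 -?one ?wout ?permw_tperm_phi.
Qed.

(* If <w, phi i> <> 0, symmetrizing w - (x_1 y_1) w over the stabilizer of
   phi i yields a nonzero multiple of phi i; the coefficients of this
   combination of translates of w sum to 0, so the constant <w_p, v> drops out. *)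
Lemma disc_eq0_perp i w v : (0 < i <= k)%N -> disc w v = 0 ->
  inVperp x y i w \/ inVperp x y i v.
Proof.
case/andP=> i0 ik /disc_eq0P; move: (_ * _ * _) => C0 wv.
have [/forallP w0|/forallPn[p0 wp0]] :=
    boolP [forall p, inner w (permw p (phi i)) == 0].
  by left; apply/inVperpP => p; apply/eqP.
right; apply/inVperpP => p.
pose t0 := tperm (x (Ordinal (leq_trans i0 ik))) (y (Ordinal (leq_trans i0 ik))).
have t0phi : permw t0 (phi i) = - phi i by apply: permw_swap_phi.
(* [t0] negates both [D] and [phi i], so the two terms of [D] contribute equally: the inner product
   of [D] with [phi i] is twice the nonzero one given by [p0]. *)
pose D := permw p0^-1%g w - permw t0 (permw p0^-1%g w).
have t0D : permw t0 D = - D.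
  by rewrite /D permwB opprB [permw t0 (permw t0 _)]permwM tperm2 permw1.
have Dphi : inner D (phi i) != 0.
  rewrite /D innerBl inner_permw invgK [inner (permw t0 _) _]inner_permw tpermV t0phi.
  rewrite innerNr opprK inner_permw invgK.
  by rewrite -mulr2n mulrn_eq0.
pose G := [pred s : {perm T} | permw s (phi i) == phi i].
pose z := \sum_(s in G) permw s D.
have zphi : inner z (phi i) != 0.
  rewrite inner_suml (eq_bigr (fun=> inner D (phi i))) => [|s /eqP sG].
    rewrite sumr_const mulrn_eq0 negb_or Dphi andbT -lt0n.
    by apply/card_gt0P; exists 1%g; rewrite inE permw1.
  by rewrite inner_permw -[in LHS]sG permwM mulgV permw1.
have zout t : permw t (phi i) = phi i -> permw t z = z.
  move=> tphi; rewrite permw_sum [RHS](reindex _ (onW_bij _ (injF_bij (mulIg t)))) /=.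
  apply: eq_big => s; last by rewrite permwM.
  by rewrite !inE -permwM -[X in _ = (_ == X)]tphi (inj_eq (@permw_inj R T k t)).
have zswap t : permw t (phi i) = - phi i -> permw t z = - z.
  (* As [t0] and [t] both negate [phi i], this map permutes the stabilizer; the sign comes from [t0]
     acting on [D]. *)
  move=> tphi; have bij : bijective (fun s => t0 * s * t)%g.
    exists (fun s => t0 * s * t^-1)%g => s.
      by rewrite !mulgA tperm2 mul1g mulgK.
    by rewrite !mulgA tperm2 mul1g mulgKV.
  rewrite permw_sum -sumrN [RHS](reindex _ (onW_bij _ bij)) /=.
  apply: eq_big => s; last by rewrite -!permwM t0D !permwN opprK.
  rewrite !inE -!permwM t0phi !permwN -[X in _ = (_ == X)]opprK -tphi eqr_opp.
  by rewrite (inj_eq (@permw_inj R T k t)).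
have zprop : forall e f, z e * phi i f = z f * phi i e.
  apply: phi_proportional => [j ji|a b ab]; first exact/zswap/permw_swap_phi.
  exact/zout/permw_tperm_phi.
have [f phif] : exists f, phi i f != 0.
  apply/existsP; apply: contraR zphi => /existsPn phi0; rewrite /inner big1 // => e _.
  by have := phi0 e; rewrite negbK => /eqP ->; rewrite mulr0.
have zf : z f != 0.
  apply: contra_neq zphi => zf; rewrite /inner big1 // => e _.
  have /eqP := zprop e f; rewrite zf mul0r mulf_eq0 (negPf phif) orbF => /eqP ->.
  by rewrite mul0r.
(* By proportionality, [z f] times the product of [v] with a translate of [phi i] equals [phi i f]
   times its product with that translate of [z]. *)
apply: (mulIf zf); rewrite mul0r -[RHS](mul0r (phi i f)).
have <- : inner (permw p z) v = 0.
  rewrite permw_sum inner_suml big1 // => s _.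
  by rewrite /D !permwB innerBl !permwM !wv subrr.
rewrite innerC /inner !mulr_suml; apply: eq_bigr => e _; rewrite !permwE.
by rewrite mulrAC [RHS]mulrAC [_ * z f]mulrC zprop.
Qed.

End Phi.

(** * The five statements assembled *)

Theorem theorem6p1 (R : realFieldType) (T : finType) (k : nat)
  (x y : 'I_k -> T) :
  (1 <= k)%N -> (2 * k <= #|T|)%N ->
  injective x -> injective y -> (forall i j, x i != y j) ->
  (* (a) *)
  (forall (i : nat) (w : weighting R T k), (1 <= i <= k)%N ->
      disc w (phi x y i) = 0 <-> inVperp x y i w) /\
  (* (b) *)
  (forall (i j : nat) (u w : weighting R T k), (i <= k)%N -> (j <= k)%N ->
      i != j -> inV x y i u -> inV x y j w -> disc u w = 0) /\
  (* (c) R^{V^(k)} = V_0 (+) ... (+) V_k *)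
  ((forall w : weighting R T k, exists u : 'I_k.+1 -> weighting R T k,
      (forall i : 'I_k.+1, inV x y i (u i)) /\ w = \sum_(i < k.+1) u i) /\
   (forall u : 'I_k.+1 -> weighting R T k,
      (forall i : 'I_k.+1, inV x y i (u i)) -> \sum_(i < k.+1) u i = 0 ->
      forall i, u i = 0)) /\
  (* (d) *)
  (forall u : 'I_k.+1 -> weighting R T k,
      (forall i : 'I_k.+1, inV x y i (u i)) ->
      forall i : 'I_k.+1, Wvec (\sum_(h < k.+1) u h) i = 0 <-> u i = 0) /\
  (* (e) *)
  (forall (t : nat) (w : 'I_t -> weighting R T k), (0 < t)%N ->
      (forall i, w i != 0) ->
      (forall i j, i != j -> disc (w i) (w j) = 0) ->
      exists P : 'I_t -> {set 'I_k.+1},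
        (forall i j, i != j -> [disjoint P i & P j]) /\
        \bigcup_(i < t) P i = [set h : 'I_k.+1 | h != ord0] /\
        (forall i, exists u : 'I_k.+1 -> weighting R T k,
           (forall h : 'I_k.+1, inV x y h (u h)) /\
           (forall h : 'I_k.+1, h != ord0 -> h \notin P i -> u h = 0) /\
           w i = \sum_(h < k.+1) u h)).
Proof.
move=> k1 kT injx injy xy.
split; first by move=> i w; apply: disc_phi_eq0P.
split; first by move=> i j u w; apply: disc_inV.
split.
  split=> [w|u uV u0 i]; first exact: inV_span.
  apply/(inVperp_sumV injx injy xy i uV); rewrite u0 => v _.
  by rewrite /inner big1 // => e _; rewrite ffunE mul0r.
split.
  move=> u uV i; apply: iff_trans _ (inVperp_sumV injx injy xy i uV).
  by apply: Wvec_eq0P => //; rewrite -ltnS.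
move=> t w t0 _ wdisc.
have [u uP] := fin_all_exists (fun i => inV_span kT injx injy xy (w i)).
have uV i : forall h : 'I_k.+1, inV x y h (u i h) := (uP i).1.
have wE i : w i = \sum_(h < k.+1) u i h := (uP i).2.
(* By [disc_eq0_perp], two different weightings cannot both have a nonzero component in the same
   [V_h] with [h] positive. *)
have once (h : 'I_k.+1) i j : h != ord0 -> u i h != 0 -> u j h != 0 -> i = j.
  move=> h0 ui uj; apply/eqP/negPn/negP => ij.
  have hk : (0 < h <= k)%N by rewrite lt0n h0 -ltnS /=.
  by case: (disc_eq0_perp injx injy xy hk (wdisc i j ij));
    rewrite wE => /(inVperp_sumV injx injy xy h (uV _))/eqP; apply/negP.
(* Indices [h] at which every component vanishes go by default to the first part, so that the parts
   cover all positive indices. *)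
pose owner h : 'I_t := odflt (Ordinal t0) [pick j | u j h != 0].
exists (fun i => [set h | (h != ord0) && (owner h == i)]); split.
  move=> i j ij; rewrite disjoint_subset; apply/subsetP => h.
  by rewrite !inE => /andP[-> /eqP ->].
split.
  apply/setP => h; rewrite inE; apply/bigcupP/idP => [[i _]|h0].
    by rewrite inE => /andP[].
  by exists (owner h) => //; rewrite inE h0 eqxx.
move=> i; exists (u i); split=> //; split=> // h h0.
rewrite inE h0 /= => hi; apply/eqP/negPn/negP => ui; move: hi.
rewrite /owner; case: pickP => [j uj|/(_ i)]; last by rewrite ui.
by rewrite (once h i j h0 ui uj) eqxx.
Qed.
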